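(* Let $G$ be a finitely generated group with finite symmetric generating set $S$, and let $\mathcal F$ be a collection of representations of $G$ on Banach spaces such that $\sup_{(\pi,E)\in\mathcal F}\|\pi(g)\|_{B(E)}<\infty$ for every $g\in S$. Then $\mathcal C_{\mathcal F}(G)$ contains a Kazhdan projection if and only if there exists $m\in\mathbf C[G]$ with $\sum_{g} m(g)=1$ such that $$\delta_S^\pi(\pi(m)x)\le \tfrac12\,\delta_S^\pi(x)\quad\text{for all }(\pi,E)\in\mathcal F\text{ and all }x\in E. \qquad ( * )$$ Moreover, if these properties hold, $m$ is as in $( * )$, and $\sigma$ is an affine action of $G$ on a Banach space $E$ whose linear part $(\pi,E)$ belongs to $\mathcal F$, then $\sigma$ has a fixed point if and only if $\delta_S^\sigma(\sigma(m)x)\le\frac12\delta_S^\sigma(x)$ for all $x\in E$.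
   Context: A representation $(\pi,E)$ of the discrete group $G$ is a group homomorphism $\pi$ from $G$ to the group of bounded invertible operators of a Banach space $E$. For $a=\sum_g a(g)g\in\mathbf C[G]$, $\pi(a)=\sum_g a(g)\pi(g)$. An affine action $\sigma$ of $G$ on $E$ with linear part $(\pi,E)$ is an action of the form $\sigma(g)x=\pi(g)x+b(g)$ with $b(gh)=b(g)+\pi(g)b(h)$; if $\sum_g m(g)=1$, $\sigma(m)x=\sum_g m(g)\sigma(g)x$. Displacement: $\delta_S^\pi(x)=\max_{s\in S}\|\pi(s)x-x\|_E$, and similarly $\delta_S^\sigma(x)=\max_{s\in S}\|\sigma(s)x-x\|_E$. $\mathcal C_{\mathcal F}(G)$ is the (Hausdorff) completion of $\mathbf C[G]$ for the seminorm $\|a\|_{\mathcal F}=\sup_{(\pi,E)\in\mathcal F}\|\pi(a)\|_{B(E)}$; it is a Banach algebra and every $(\pi,E)\in\mathcal F$ extends to it. $E^\pi=\{x\in E:\pi(g)x=x\ \forall g\in G\}$. A Kazhdan projection in $\mathcal C_{\mathcal F}(G)$ is an idempotent $p$ in the closure of $\{m\in\mathbf C[G]:\sum_g m(g)=1\}$ such that for every $(\pi,E)\in\mathcal F$, $\pi(p)$ is a projection onto $E^\pi$. *)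

(* Defs.v *)
From HB Require Import structures.
From mathcomp Require Import all_boot all_order all_algebra finmap.
From mathcomp Require Import mathcomp_extra boolp classical_sets functions reals.
From mathcomp Require Import interval_inference topology normedtype sequences.
From mathcomp Require Import complex lra.

Set Implicit Arguments.
Unset Strict Implicit.
Unset Printing Implicit Defensive.

Import Order.TTheory GRing.Theory Num.Theory.
Import numFieldNormedType.Exports.

Local Open Scope fset_scope.
Local Open Scope ring_scope.

Definition group_algebra (K : comNzRingType) (G : groupType) :=
  {fsfun G -> K with 0}.

Section GroupAlgebra.
Variables (K : comNzRingType) (G : groupType).
Local Notation KG := (group_algebra K G).
Implicit Types (a b c : KG) (g h : G) (k : K).

HB.instance Definition _ := Choice.on KG.

Definition ga_zero : KG := [fsfun for fun=> 0].
Definition ga_opp a : KG := [fsfun g in finsupp a => - a g].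
Definition ga_add a b : KG := [fsfun g in finsupp a `|` finsupp b => a g + b g].
Definition ga_scale k a : KG := [fsfun g in finsupp a => k * a g].

Lemma ga_zeroE g : ga_zero g = 0. Proof. by rewrite fsfunE. Qed.
Lemma ga_oppE a g : ga_opp a g = - a g.
Proof. by rewrite fsfunE; case: finsuppP; rewrite ?oppr0. Qed.
Lemma ga_addE a b g : ga_add a b g = a g + b g.
Proof.
rewrite fsfunE in_fsetU.
by case: (finsuppP a g) => _ /=; case: (finsuppP b g); rewrite ?addr0.
Qed.
Lemma ga_scaleE k a g : ga_scale k a g = k * a g.
Proof. by rewrite fsfunE; case: finsuppP; rewrite ?mulr0. Qed.

Fact ga_addA : associative ga_add.
Proof. by move=> a b c; apply/fsfunP => g; rewrite !ga_addE addrA. Qed.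
Fact ga_addC : commutative ga_add.
Proof. by move=> a b; apply/fsfunP => g; rewrite !ga_addE addrC. Qed.
Fact ga_add0 : left_id ga_zero ga_add.
Proof. by move=> a; apply/fsfunP => g; rewrite ga_addE ga_zeroE add0r. Qed.
Fact ga_addN : left_inverse ga_zero ga_opp ga_add.
Proof.
by move=> a; apply/fsfunP => g; rewrite ga_addE ga_oppE ga_zeroE addNr.
Qed.
HB.instance Definition _ :=
  GRing.isZmodule.Build KG ga_addA ga_addC ga_add0 ga_addN.

Lemma ga0E g : (0 : KG) g = 0. Proof. exact: ga_zeroE. Qed.
Lemma gaDE a b g : (a + b) g = a g + b g. Proof. exact: ga_addE. Qed.
Lemma gaNE a g : (- a) g = - a g. Proof. exact: ga_oppE. Qed.

Fact ga_scaleA k l a : ga_scale k (ga_scale l a) = ga_scale (k * l) a.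
Proof. by apply/fsfunP => g; rewrite !ga_scaleE mulrA. Qed.
Fact ga_scale1 : left_id 1 ga_scale.
Proof. by move=> a; apply/fsfunP => g; rewrite ga_scaleE mul1r. Qed.
Fact ga_scaleDr : right_distributive ga_scale +%R.
Proof.
by move=> k a b; apply/fsfunP => g; rewrite !(gaDE, ga_scaleE) mulrDr.
Qed.
Fact ga_scaleDl a : {morph ga_scale^~ a : k l / k + l}.
Proof. by move=> k l; apply/fsfunP => g; rewrite !(gaDE, ga_scaleE) mulrDl. Qed.
HB.instance Definition _ := GRing.Zmodule_isLmodule.Build K KG
  ga_scaleA ga_scale1 ga_scaleDr ga_scaleDl.

Lemma gaZE k a g : (k *: a) g = k * a g. Proof. exact: ga_scaleE. Qed.

(* The linear extension of f to the group algebra. *)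
Definition lsum {V : lmodType K} a (f : G -> V) : V :=
  \sum_(g <- finsupp a) a g *: f g.

Lemma lsum_widen (V : lmodType K) a (f : G -> V) (D : {fset G}) :
  finsupp a `<=` D -> lsum a f = \sum_(g <- D) a g *: f g.
Proof.
move=> aD; rewrite /lsum; apply: big_fset_incl => // g _ ga.
by rewrite fsfun_dflt// scale0r.
Qed.

Lemma lsum_is_linear (V : lmodType K) (f : G -> V) : linear (lsum^~ f).
Proof.
move=> k a b; pose D := finsupp (k *: a + b) `|` (finsupp a `|` finsupp b).
have aD : finsupp a `<=` D by apply/fsubsetP => g ga; rewrite !in_fsetU ga orbT.
have bD : finsupp b `<=` D by apply/fsubsetP => g gb; rewrite !in_fsetU gb !orbT.
rewrite (lsum_widen f aD) (lsum_widen f bD) (lsum_widen f (fsubsetUl _ _ : _ `<=` D)).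
rewrite scaler_sumr -big_split; apply: eq_bigr => g _ /=.
by rewrite gaDE gaZE scalerDl scalerA.
Qed.

Lemma lsumD (V : lmodType K) (f : G -> V) a b :
  lsum (a + b) f = lsum a f + lsum b f.
Proof. by have := lsum_is_linear f 1 a b; rewrite !scale1r. Qed.
Lemma lsum0 (V : lmodType K) (f : G -> V) : lsum 0 f = 0.
Proof.
by have := lsum_is_linear f (-1) 0 0; rewrite scaler0 scaleN1r addNr addr0.
Qed.
Lemma lsumZ (V : lmodType K) (f : G -> V) k a : lsum (k *: a) f = k *: lsum a f.
Proof. by have := lsum_is_linear f k a 0; rewrite lsum0 !addr0. Qed.
Lemma lsum_sum (V : lmodType K) (f : G -> V) I (r : seq I) (F : I -> KG) :
  lsum (\sum_(i <- r) F i) f = \sum_(i <- r) lsum (F i) f.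
Proof.
by elim/big_rec2: _ => [|i x y _ IH]; rewrite ?lsum0// lsumD IH.
Qed.

Lemma lsum_lsum (V : lmodType K) a (f : G -> KG) (h : G -> V) :
  lsum (lsum a f) h = lsum a (fun g => lsum (f g) h).
Proof.
by rewrite [lsum a f]/lsum lsum_sum; apply: eq_bigr => g _; rewrite lsumZ.
Qed.

Lemma lsumDf (V : lmodType K) a (f h : G -> V) :
  lsum a (fun g => f g + h g) = lsum a f + lsum a h.
Proof. by rewrite -big_split; apply: eq_bigr => g _; rewrite scalerDr. Qed.

Lemma lsum_linear (V W : lmodType K) (T : {linear V -> W}) a (f : G -> V) :
  T (lsum a f) = lsum a (T \o f).
Proof. by rewrite linear_sum; apply: eq_bigr => g _; rewrite linearZ. Qed.

Lemma eq_lsum (V : lmodType K) a (f h : G -> V) : f =1 h -> lsum a f = lsum a h.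
Proof. by move=> fh; apply: eq_bigr => g _; rewrite fh. Qed.

Definition ga_delta g : KG := [fsfun h in [fset g] => 1].

Lemma ga_deltaE g h : ga_delta g h = (h == g)%:R.
Proof. by rewrite fsfunE inE; case: eqP. Qed.

Lemma lsum_delta (V : lmodType K) g (f : G -> V) : lsum (ga_delta g) f = f g.
Proof.
rewrite (@lsum_widen _ _ _ [fset g]); last first.
  apply/fsubsetP => h; rewrite mem_finsupp ga_deltaE inE.
  by case: (h == g); rewrite ?eqxx.
by rewrite big_seq_fset1 ga_deltaE eqxx scale1r.
Qed.

Lemma lsum_id a : lsum a ga_delta = a.
Proof.
apply/fsfunP => g.
have E (r : seq G) (F : G -> KG) :
    (\sum_(h <- r) F h) g = \sum_(h <- r) F h g.
  by elim/big_rec2: _ => [|h x y _ <-]; rewrite ?ga0E ?gaDE.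
rewrite E; under eq_bigr do rewrite gaZE ga_deltaE.
case: (finsuppP a g) => [ga|ga].
  rewrite big1_seq// => h /= ha; case: eqP => [gh|]; last by rewrite mulr0.
  by rewrite -gh (negPf ga) in ha.
rewrite (big_fsetD1 g)//= eqxx mulr1 big1_seq ?addr0// => h.
by rewrite !inE eq_sym => /andP[_ /andP[/negPf -> _]]; rewrite mulr0.
Qed.

(* Convolution: the product of sum_g a(g) g and sum_h b(h) h is
   sum_(g, h) a(g) b(h) gh. *)
Definition ga_mul a b : KG :=
  lsum a (fun g => lsum b (fun h => ga_delta (g * h)%g)).

Fact ga_mulA : associative ga_mul.
Proof.
move=> a b c; rewrite /ga_mul !lsum_lsum; apply: eq_lsum => g.
rewrite !lsum_lsum; apply: eq_lsum => h; rewrite lsum_lsum lsum_delta.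
by apply: eq_lsum => l; rewrite lsum_delta mulgA.
Qed.
Fact ga_mul1 : left_id (ga_delta 1%g) ga_mul.
Proof.
move=> a; rewrite /ga_mul lsum_delta -[RHS]lsum_id.
by apply: eq_lsum => h; rewrite mul1g.
Qed.
Fact ga_mulr1 : right_id (ga_delta 1%g) ga_mul.
Proof.
move=> a; rewrite /ga_mul -[RHS]lsum_id.
by apply: eq_lsum => h; rewrite lsum_delta mulg1.
Qed.
Fact ga_mulDl : left_distributive ga_mul +%R.
Proof. by move=> a b c; rewrite /ga_mul lsumD. Qed.
Fact ga_mulDr : right_distributive ga_mul +%R.
Proof.
by move=> a b c; rewrite /ga_mul -lsumDf; apply: eq_lsum => g; rewrite lsumD.
Qed.
Fact ga_one_neq0 : ga_delta 1%g != 0.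
Proof.
apply/eqP => /fsfunP /(_ 1%g); rewrite ga_deltaE eqxx ga0E => /eqP.
by rewrite oner_eq0.
Qed.
HB.instance Definition _ := GRing.Zmodule_isNzRing.Build KG
  ga_mulA ga_mul1 ga_mulr1 ga_mulDl ga_mulDr ga_one_neq0.

Fact ga_scaleAl k a b : k *: (a * b) = (k *: a) * b.
Proof. by rewrite /GRing.mul/= /ga_mul lsumZ. Qed.
HB.instance Definition _ := GRing.Lmodule_isLalgebra.Build K KG ga_scaleAl.

Definition augmentation a : K := \sum_(g <- finsupp a) a g.

End GroupAlgebra.

Local Open Scope classical_set_scope.
Local Open Scope complex_scope.
Local Open Scope quotient_scope.

(* The norm of a normed module over R[i] takes its values in R[i]; it is real. *)
Definition rnorm (R : realType) (E : normedModType R[i]) (x : E) : R :=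
  complex.Re `|x|.

Lemma real_complex_gt0 (R : realType) (e : R) : (0 < e%:C) = (0 < e).
Proof. exact: ltcR. Qed.

Section RNorm.
Variables (R : realType) (E : normedModType R[i]).
Implicit Types x y z : E.

Lemma rnormE x : (rnorm x)%:C = `|x|.
Proof. by rewrite RRe_real ?normr_real. Qed.

Lemma rnorm_ge0 x : 0 <= rnorm x.
Proof. by rewrite -ler0c rnormE. Qed.

Lemma rnormD x y : rnorm (x + y) <= rnorm x + rnorm y.
Proof. by have := ler_normD x y; rewrite -!rnormE -rmorphD lecR. Qed.

Lemma rnormN x : rnorm (- x) = rnorm x.
Proof. by rewrite /rnorm normrN. Qed.

Lemma rnorm_distC x y : rnorm (x - y) = rnorm (y - x).
Proof. by rewrite /rnorm distrC. Qed.

Lemma rnorm_distD y x z : rnorm (x - z) <= rnorm (x - y) + rnorm (y - z).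
Proof. by rewrite (le_trans _ (rnormD _ _))// addrA subrK. Qed.

Lemma rnormZ k x : rnorm (k *: x) = complex.Re `|k| * rnorm x.
Proof.
apply: (@complexI R).
by rewrite rnormE normrZ -(rnormE x) -[in LHS](RRe_real (normr_real k)) -rmorphM.
Qed.

Lemma rnorm0 : rnorm (0 : E) = 0. Proof. by rewrite /rnorm normr0. Qed.

Lemma rnorm0_eq0 x : rnorm x = 0 -> x = 0.
Proof. by move=> x0; apply/normr0_eq0; rewrite -rnormE x0. Qed.

Lemma cvg_rnormP (F : set_system E) {FF : Filter F} x :
  F --> x <-> forall e : R, 0 < e -> \forall y \near F, rnorm (x - y) < e.
Proof.
split=> [/cvgrPdist_lt Fx e e0|Fx].
  have := Fx e%:C; rewrite real_complex_gt0 => /(_ e0).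
  by apply: filterS => y; rewrite -rnormE ltcR.
apply/cvgrPdist_lt => e e0.
have er : (complex.Re e)%:C = e by rewrite RRe_real// gtr0_real.
have := Fx (complex.Re e); rewrite -real_complex_gt0 er => /(_ e0).
by apply: filterS => y; rewrite -ltcR rnormE er.
Qed.
End RNorm.

Record alg_seminorm (R : realType) (A : lalgType R[i]) := AlgSeminorm {
  sn_fun :> A -> R;
  snD : forall a b, sn_fun (a + b) <= sn_fun a + sn_fun b;
  snZ : forall k a, sn_fun (k *: a) = complex.Re `|k| * sn_fun a;
  snM : forall a b, sn_fun (a * b) <= sn_fun a * sn_fun b
}.

(* The Hausdorff completion of a seminormed algebra: Cauchy sequences modulo null
   sequences, with the termwise operations and the limit of the seminorms as
   norm. It is equipped below with its ring, complex vector space and complete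
   normed space structures; hcemb is the canonical map from the algebra. *)
Section HausdorffCompletion.
Variables (R : realType) (A : lalgType R[i]) (N : alg_seminorm A).
Implicit Types (a b : A).

Lemma sn0 : N 0 = 0.
Proof. by rewrite -(scale0r 0) snZ normr0 mul0r. Qed.

Lemma snN a : N (- a) = N a.
Proof. by rewrite -scaleN1r snZ normrN normr1 mul1r. Qed.

Lemma sn_ge0 a : 0 <= N a.
Proof.
by have := snD N a (- a); rewrite subrr sn0 snN -mulr2n pmulrn_lge0.
Qed.

Lemma snBC a b : N (a - b) = N (b - a).
Proof. by rewrite -snN opprB. Qed.

Lemma sn_dist a b c : N (a - c) <= N (a - b) + N (b - c).
Proof. by rewrite -[a in N (a - c)](subrK b) -addrA snD. Qed.

Lemma sn_distB a b : `|N a - N b| <= N (a - b).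
Proof.
rewrite ler_norml; apply/andP; split.
  rewrite lerNl opprB lerBlDr snBC; apply: le_trans (snD _ _ _).
  by rewrite subrK.
rewrite lerBlDr; apply: le_trans (snD _ _ _).
by rewrite subrK.
Qed.

Definition sn_cauchy (u : nat -> A) := forall e : R, 0 < e ->
  exists k, forall m n, (k <= m)%N -> (k <= n)%N -> N (u m - u n) < e.

Definition sn_null (u : nat -> A) := forall e : R, 0 < e ->
  exists k, forall n, (k <= n)%N -> N (u n) < e.

Lemma sn_cauchy_bounded u : sn_cauchy u -> exists2 M, 0 < M & forall n, N (u n) <= M.
Proof.
move=> /(_ 1 ltr01)[k uk].
exists (1 + \sum_(i < k.+1) N (u i)).
  by rewrite ltr_wpDr// sumr_ge0// => i _; exact: sn_ge0.
have s i : (i < k.+1)%N -> N (u i) <= \sum_(i < k.+1) N (u i).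
  move=> ik; rewrite (bigD1 (Ordinal ik))//= lerDl sumr_ge0// => j _.
  exact: sn_ge0.
move=> n; have [nk|kn] := ltnP n k.+1.
  by rewrite (le_trans (s _ nk))// lerDr.
rewrite -(subrK (u k) (u n)) (le_trans (snD _ _ _))// lerD//; last exact: s.
by rewrite ltW// uk// ltnW.
Qed.

Definition cauchyp : {pred nat -> A} := fun u => `[< sn_cauchy u >].

Fact cauchyp_subring : subring_closed cauchyp.
Proof.
split=> [|u v /asboolP cu /asboolP cv|u v /asboolP cu /asboolP cv].
- by apply/asboolP => e e0; exists 0%N => m n _ _; rewrite subrr sn0.
- apply/asboolP => e e0.
  have e2 : 0 < e / 2 by rewrite divr_gt0.
  have [k uk] := cu _ e2; have [l vl] := cv _ e2.
  exists (maxn k l) => m n; rewrite !geq_max => /andP[km lm] /andP[kn ln].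
  rewrite [X in N X](_ : _ = (u m - u n) + - (v m - v n)); last first.
    rewrite -[LHS]/(u m - v m - (u n - v n)) !opprB addrACA [RHS]addrACA.
    by congr (_ + _); rewrite addrC.
  rewrite (le_lt_trans (snD _ _ _))// snN (splitr e) ltrD//; [exact: uk|exact: vl].
- apply/asboolP => e e0.
  have [M M0 uM] := sn_cauchy_bounded cu.
  have [L L0 vL] := sn_cauchy_bounded cv.
  have eL : 0 < e / 2 / L by rewrite !divr_gt0.
  have eM : 0 < e / 2 / M by rewrite !divr_gt0.
  have [k uk] := cu _ eL; have [l vl] := cv _ eM.
  exists (maxn k l) => m n; rewrite !geq_max => /andP[km lm] /andP[kn ln].
  rewrite [X in N X](_ : _ = (u m - u n) * v m + u n * (v m - v n)); last first.
    by rewrite mulrBl mulrBr addrA subrK.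
  rewrite (le_lt_trans (snD _ _ _))// (splitr e) ltrD//.
    rewrite (le_lt_trans (snM _ _ _))//.
    rewrite (le_lt_trans (ler_wpM2l (sn_ge0 _) (vL m)))//.
    by rewrite -ltr_pdivlMr// uk.
  rewrite (le_lt_trans (snM _ _ _))//.
  rewrite (le_lt_trans (ler_wpM2r (sn_ge0 _) (uM n)))//.
  by rewrite mulrC -ltr_pdivlMr// vl.
Qed.

Lemma Re_norm_ge0 (k : R[i]) : 0 <= complex.Re `|k|.
Proof. by rewrite -ler0c (RRe_real (normr_real _)). Qed.

Fact cauchyp_scaler : scaler_closed cauchyp.
Proof.
move=> k u /asboolP cu; apply/asboolP => e e0.
have k1 : 0 < complex.Re `|k| + 1 by rewrite ltr_wpDl// Re_norm_ge0.
have [l ul] := cu _ (divr_gt0 e0 k1); exists l => m n lm ln.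
rewrite -[_ m - _ n]/(k *: u m - k *: u n) -scalerBr snZ.
have := ul _ _ lm ln; rewrite ltr_pdivlMr// mulrC; apply: le_lt_trans.
by rewrite ler_wpM2r ?sn_ge0// lerDl.
Qed.

HB.instance Definition _ :=
  GRing.isSubringClosed.Build (nat -> A) cauchyp cauchyp_subring.
HB.instance Definition _ :=
  GRing.isScaleClosed.Build R[i] (nat -> A) cauchyp cauchyp_scaler.

Record cauchy_seq := CauchySeq {
  cseq :> nat -> A;
  _ : cseq \in cauchyp
}.

HB.instance Definition _ := [isSub for cseq].
HB.instance Definition _ := [Choice of cauchy_seq by <:].
HB.instance Definition _ := [SubChoice_isSubZmodule of cauchy_seq by <:].
HB.instance Definition _ := GRing.SubZmodule_isSubPzRing.Build
  (nat -> A) cauchyp cauchy_seq cauchyp_subring.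
HB.instance Definition _ := [SubZmodule_isSubLmodule of cauchy_seq by <:].

Implicit Types (u v w : cauchy_seq).

Lemma cseqP u : sn_cauchy u. Proof. by have /asboolP := valP u. Qed.

Lemma cseqD u v n : (u + v) n = u n + v n. Proof. by []. Qed.
Lemma cseqN u n : (- u) n = - u n. Proof. by []. Qed.
Lemma cseqM u v n : (u * v) n = u n * v n. Proof. by []. Qed.
Lemma cseqZ k u n : (k *: u) n = k *: u n. Proof. by []. Qed.
Lemma cseq1 n : (1 : cauchy_seq) n = 1. Proof. by []. Qed.
Lemma cseq0 n : (0 : cauchy_seq) n = 0. Proof. by []. Qed.

Definition nullp : {pred cauchy_seq} := fun u => `[< sn_null u >].

Fact nullp_zmod : zmod_closed nullp.
Proof.
split=> [|u v /asboolP nu /asboolP nv].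
  by apply/asboolP => e e0; exists 0%N => n _; rewrite cseq0 sn0.
apply/asboolP => e e0; have e2 : 0 < e / 2 by rewrite divr_gt0.
have [k uk] := nu _ e2; have [l vl] := nv _ e2.
exists (maxn k l) => n; rewrite !geq_max => /andP[kn ln].
rewrite cseqD cseqN (le_lt_trans (snD _ _ _))// snN (splitr e) ltrD//.
  exact: uk.
exact: vl.
Qed.

HB.instance Definition _ := GRing.isZmodClosed.Build cauchy_seq nullp nullp_zmod.


Lemma nullp_mulr u v : u \in nullp -> u * v \in nullp.
Proof.
move=> /asboolP nu; apply/asboolP => e e0.
have [M M0 vM] := sn_cauchy_bounded (cseqP v).
have [k uk] := nu _ (divr_gt0 e0 M0); exists k => n kn.
rewrite cseqM (le_lt_trans (snM _ _ _))//.
rewrite (le_lt_trans (ler_wpM2l (sn_ge0 _) (vM n)))//.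
by rewrite -ltr_pdivlMr// uk.
Qed.

Lemma nullp_mull u v : u \in nullp -> v * u \in nullp.
Proof.
move=> /asboolP nu; apply/asboolP => e e0.
have [M M0 vM] := sn_cauchy_bounded (cseqP v).
have [k uk] := nu _ (divr_gt0 e0 M0); exists k => n kn.
rewrite cseqM (le_lt_trans (snM _ _ _))//.
rewrite (le_lt_trans (ler_wpM2r (sn_ge0 _) (vM n)))//.
by rewrite mulrC -ltr_pdivlMr// uk.
Qed.

Lemma nullpZ k u : u \in nullp -> k *: u \in nullp.
Proof.
move=> /asboolP nu; apply/asboolP => e e0.
have k1 : 0 < complex.Re `|k| + 1 by rewrite ltr_wpDl// Re_norm_ge0.
have [l ul] := nu _ (divr_gt0 e0 k1); exists l => n ln.
rewrite cseqZ snZ.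
have := ul _ ln; rewrite ltr_pdivlMr// mulrC; apply: le_lt_trans.
by rewrite ler_wpM2r ?sn_ge0// lerDl.
Qed.

Definition hcompletion := Quotient.quot nullp.
HB.instance Definition _ := Choice.on hcompletion.
HB.instance Definition _ : EqQuotient cauchy_seq (Quotient.equiv nullp) hcompletion :=
  EqQuotient.on hcompletion.
HB.instance Definition _ := GRing.Zmodule.on hcompletion.
Local Notation hc := hcompletion.

Definition hcpi : cauchy_seq -> hc := \pi_hc.

Lemma hcpiP u v : reflect (hcpi u = hcpi v) (u - v \in nullp).
Proof. by rewrite Quotient.idealrBE; exact: eqP. Qed.

Lemma hcpi_repr (x : hc) : hcpi (repr x) = x.
Proof. exact: reprK. Qed.

Lemma repr_hcpi u : repr (hcpi u) - u \in nullp.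
Proof. by apply/hcpiP; rewrite hcpi_repr. Qed.

Lemma hcpiD u v : hcpi (u + v) = hcpi u + hcpi v.
Proof. exact: Quotient.pi_add. Qed.
Lemma hcpiN u : hcpi (- u) = - hcpi u.
Proof. exact: Quotient.pi_opp. Qed.
Lemma hcpi0 : hcpi 0 = 0.
Proof. by rewrite -(subrr 0) hcpiD hcpiN subrr. Qed.

Definition hc_mul (x y : hc) : hc := hcpi (repr x * repr y).
Definition hc_scale (k : R[i]) (x : hc) : hc := hcpi (k *: repr x).

Lemma hc_mul_pi u v : hcpi (u * v) = hc_mul (hcpi u) (hcpi v).
Proof.
apply/esym/hcpiP.
rewrite [X in X \in _](_ : _ = (repr (hcpi u) - u) * repr (hcpi v)
                              + u * (repr (hcpi v) - v)); last first.
  by rewrite mulrBl mulrBr addrA subrK.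
apply: rpredD; first exact/nullp_mulr/repr_hcpi.
exact/nullp_mull/repr_hcpi.
Qed.

Lemma hc_scale_pi k u : hcpi (k *: u) = hc_scale k (hcpi u).
Proof. by apply/esym/hcpiP; rewrite -scalerBr nullpZ ?repr_hcpi. Qed.

Fact hc_mulA : associative hc_mul.
Proof.
by move=> x y z; rewrite -[x]hcpi_repr -[y]hcpi_repr -[z]hcpi_repr -!hc_mul_pi mulrA.
Qed.
Fact hc_mul1 : left_id (hcpi 1) hc_mul.
Proof. by move=> x; rewrite -[x]hcpi_repr -hc_mul_pi mul1r. Qed.
Fact hc_mulr1 : right_id (hcpi 1) hc_mul.
Proof. by move=> x; rewrite -[x]hcpi_repr -hc_mul_pi mulr1. Qed.
Fact hc_mulDl : left_distributive hc_mul +%R.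
Proof.
move=> x y z; rewrite -[x]hcpi_repr -[y]hcpi_repr -[z]hcpi_repr.
by rewrite -hcpiD -!hc_mul_pi -hcpiD mulrDl.
Qed.
Fact hc_mulDr : right_distributive hc_mul +%R.
Proof.
move=> x y z; rewrite -[x]hcpi_repr -[y]hcpi_repr -[z]hcpi_repr.
by rewrite -hcpiD -!hc_mul_pi -hcpiD mulrDr.
Qed.
HB.instance Definition _ := GRing.Zmodule_isPzRing.Build hc
  hc_mulA hc_mul1 hc_mulr1 hc_mulDl hc_mulDr.

Fact hc_scaleA k l x : hc_scale k (hc_scale l x) = hc_scale (k * l) x.
Proof. by rewrite -[x]hcpi_repr -!hc_scale_pi scalerA. Qed.
Fact hc_scale1 : left_id 1 hc_scale.
Proof. by move=> x; rewrite -[x]hcpi_repr -!hc_scale_pi scale1r. Qed.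
Fact hc_scaleDr : right_distributive hc_scale +%R.
Proof.
move=> k x y; rewrite -[x]hcpi_repr -[y]hcpi_repr -hcpiD -!hc_scale_pi -hcpiD.
by rewrite scalerDr.
Qed.
Fact hc_scaleDl x : {morph hc_scale^~ x : k l / k + l}.
Proof. by move=> k l; rewrite -[x]hcpi_repr -!hc_scale_pi -hcpiD scalerDl. Qed.
HB.instance Definition _ := GRing.Zmodule_isLmodule.Build R[i] hc
  hc_scaleA hc_scale1 hc_scaleDr hc_scaleDl.

Lemma hcpiM u v : hcpi (u * v) = hcpi u * hcpi v.
Proof. exact: hc_mul_pi. Qed.
Lemma hcpiZ k u : hcpi (k *: u) = k *: hcpi u.
Proof. exact: hc_scale_pi. Qed.

Lemma hc_scaleAl k (x y : hc) : k *: (x * y) = (k *: x) * y.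
Proof.
rewrite -[x]hcpi_repr -[y]hcpi_repr -hcpiM -!hcpiZ -hcpiM; congr hcpi.
by apply/val_inj/funext => n; exact: scalerAl.
Qed.

Definition sn_lim u : R := lim (N (u n) @[n --> \oo]).

Lemma sn_cvg u : N (u n) @[n --> \oo] --> sn_lim u.
Proof.
suff : cvg (N (u n) @[n --> \oo]) by [].
apply/cauchy_cvgP/cauchy_ballP => e e0.
have [k uk] := cseqP u e0.
exists ([set x | exists2 n, (k <= n)%N & x = N (u n)],
        [set x | exists2 n, (k <= n)%N & x = N (u n)]) => /=.
  by split; exists k => // n kn /=; exists n.
move=> [x y] /= [[m km ->] [n kn ->]]; rewrite /ball/=.
by rewrite (le_lt_trans (sn_distB _ _))// uk.
Qed.

Arguments sn_cvg : clear implicits.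

Lemma sn_lim_ge0 u : 0 <= sn_lim u.
Proof.
by apply: limr_ge; [exact: sn_cvg|apply: nearW => n; exact: sn_ge0].
Qed.

Lemma sn_lim_null u : (u \in nullp) = (sn_lim u == 0).
Proof.
apply/asboolP/eqP => [nu|u0 e e0].
  apply: (cvg_lim (@Rhausdorff R)).
  apply/cvgrPdist_lt => e e0; have [k uk] := nu _ e0.
  exists k => // n kn /=; rewrite sub0r normrN ger0_norm ?sn_ge0//; exact: uk.
have /cvgrPdist_lt/(_ e e0)[k _ uk] := sn_cvg u; exists k => n kn.
by have := uk n kn; rewrite u0 sub0r normrN ger0_norm ?sn_ge0.
Qed.

Lemma sn_limD u v : sn_lim (u + v) <= sn_lim u + sn_lim v.
Proof.
apply: ler_cvg_to (sn_cvg _) (cvgD (sn_cvg u) (sn_cvg v)) _.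
by apply: nearW => n; exact: snD.
Qed.

Lemma sn_limM u v : sn_lim (u * v) <= sn_lim u * sn_lim v.
Proof.
apply: ler_cvg_to (sn_cvg _) (cvgM (sn_cvg u) (sn_cvg v)) _.
by apply: nearW => n; exact: snM.
Qed.

Lemma sn_limZ k u : sn_lim (k *: u) = complex.Re `|k| * sn_lim u.
Proof.
apply: (cvg_lim (@Rhausdorff R)).
under eq_cvg do rewrite cseqZ snZ.
exact: cvgM (cvg_cst _) (sn_cvg u).
Qed.

Lemma eq_sn_lim u v : hcpi u = hcpi v -> sn_lim u = sn_lim v.
Proof.
move=> /hcpiP nuv; apply/eqP; rewrite eq_le; apply/andP; split.
  rewrite -{1}(subrK v u) (le_trans (sn_limD _ _))//.
  by move: nuv; rewrite sn_lim_null => /eqP ->; rewrite add0r.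
rewrite -{1}(subrK u v) (le_trans (sn_limD _ _))//.
move: nuv; rewrite -rpredN opprB sn_lim_null => /eqP ->; by rewrite add0r.
Qed.

Definition hc_norm (x : hc) : R[i] := (sn_lim (repr x))%:C.

Lemma hc_normE u : hc_norm (hcpi u) = (sn_lim u)%:C.
Proof. by congr (_%:C); apply: eq_sn_lim; rewrite hcpi_repr. Qed.

Fact hc_normD x y : hc_norm (x + y) <= hc_norm x + hc_norm y.
Proof.
rewrite -[x]hcpi_repr -[y]hcpi_repr -hcpiD !hc_normE -rmorphD lecR.
exact: sn_limD.
Qed.
Fact hc_normZ k x : hc_norm (k *: x) = `|k| * hc_norm x.
Proof.
rewrite -[x]hcpi_repr -hcpiZ !hc_normE sn_limZ.
by rewrite -[in RHS](RRe_real (normr_real k)) -rmorphM.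
Qed.
Fact hc_norm0_eq0 x : hc_norm x = 0 -> x = 0.
Proof.
rewrite -[x]hcpi_repr hc_normE => -[] /eqP; rewrite -sn_lim_null => x0.
by rewrite -hcpi0; apply/hcpiP; rewrite subr0.
Qed.
HB.instance Definition _ := Lmodule_isNormed.Build R[i] hc
  hc_normD hc_normZ hc_norm0_eq0.


Lemma rnorm_hcpi u : rnorm (hcpi u) = sn_lim u.
Proof. by apply: (@complexI R); rewrite rnormE -hc_normE. Qed.

Lemma hc_normM (x y : hc) : `|x * y| <= `|x| * `|y|.
Proof.
rewrite -[x]hcpi_repr -[y]hcpi_repr -hcpiM /Num.norm/= !hc_normE -rmorphM lecR.
exact: sn_limM.
Qed.

Fact cst_cauchy a : (fun=> a) \in cauchyp.
Proof.
by apply/asboolP => e e0; exists 0%N => m n _ _; rewrite subrr sn0.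
Qed.

Definition cst_cseq a : cauchy_seq := CauchySeq (cst_cauchy a).

Definition hcemb a : hc := hcpi (cst_cseq a).

Lemma hcemb_is_linear : linear hcemb.
Proof.
move=> k a b; rewrite /hcemb -hcpiZ -hcpiD; congr hcpi.
exact/val_inj/funext.
Qed.

HB.instance Definition _ :=
  GRing.isLinear.Build R[i] A hc *:%R hcemb hcemb_is_linear.

Lemma hcembM a b : hcemb (a * b) = hcemb a * hcemb b.
Proof. by rewrite /hcemb -hcpiM; congr hcpi; exact/val_inj/funext. Qed.

Lemma hcemb1 : hcemb 1 = 1.
Proof. by congr hcpi; exact/val_inj/funext. Qed.

Lemma norm_hcemb a : `|hcemb a| = (N a)%:C.
Proof.
rewrite /Num.norm/= hc_normE; congr (_%:C).
rewrite -[LHS]/(lim (N a @[n --> \oo])).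
by rewrite lim_cst.
Qed.

Lemma rnorm_hcemb a : rnorm (hcemb a) = N a.
Proof. by apply: (@complexI R); rewrite rnormE norm_hcemb. Qed.

Lemma hcemb_approx u (e : R) k : (forall n, (k <= n)%N -> N (u n - u k) <= e) ->
  rnorm (hcpi u - hcemb (u k)) <= e.
Proof.
move=> uk; rewrite -lecR rnormE.
rewrite /hcemb -hcpiN -hcpiD /Num.norm/= hc_normE lecR.
apply: limr_le; first exact: (sn_cvg (u - cst_cseq (u k))).
by exists k => // n /= kn; rewrite cseqD cseqN uk.
Qed.

Lemma hcemb_cvg u : hcemb (u n) @[n --> \oo] --> hcpi u.
Proof.
apply/cvg_rnormP => e e0.
have e2 : 0 < e / 2 by rewrite divr_gt0.
have [k uk] := cseqP u e2; exists k => // n /= kn.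
apply: (@le_lt_trans _ _ (e / 2)); last by rewrite ltr_pdivrMr// ltr_pMr// ltr1n.
by apply: hcemb_approx => m nm; rewrite ltW// uk// (leq_trans kn).
Qed.

Arguments hcemb_cvg : clear implicits.

Lemma hcemb_dense : dense (range hcemb).
Proof.
move=> O [x Ox] oO; have := open_nbhs_nbhs (conj oO Ox).
rewrite -[x]hcpi_repr => /(hcemb_cvg (repr x)) [k _ /(_ k (leqnn k)) /= Ok].
by exists (hcemb (repr x k)); split => //; exists (repr x k).
Qed.

Lemma hcemb_densew (x : hc) (e : R) : 0 < e -> exists a, rnorm (x - hcemb a) < e.
Proof.
move=> e0; have /cvg_rnormP/(_ e e0) := hcemb_cvg (repr x).
by rewrite hcpi_repr => -[k _ /(_ k (leqnn k)) /= ?]; exists (repr x k).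
Qed.

Fact hc_complete (F : set_system hc) : ProperFilter F -> cauchy F -> cvg F.
Proof.
move=> FF /cauchyP Fc.
pose d n : R := n.+1%:R^-1.
have d0 n : 0 < d n by rewrite invr_gt0.
have d_le m n : (m <= n)%N -> d n <= d m.
  by move=> mn; rewrite lef_pV2 ?posrE// ler_nat.
have d_lt (e : R) : 0 < e -> exists k, d k < e.
  move=> /posnumP[{}e].
  by have [k _ /(_ k (leqnn k)) /= dk] := near_infty_natSinv_lt e; exists k.
have /choice[x Fx] n : exists x, F [set y | rnorm (x - y) < d n].
  have [|x Fx] := Fc (d n)%:C; first by rewrite real_complex_gt0.
  exists x; apply: filterS Fx => y /=; rewrite -ball_normE /=.
  by rewrite -rnormE ltcR.
have /choice[a xa] n := hcemb_densew (x n) (d0 n).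
have a_dist m n : N (a m - a n) < d m + d m + (d n + d n).
  have [y [/= xym xyn]] := filter_ex (filterI (Fx m) (Fx n)).
  rewrite -rnorm_hcemb linearB/=.
  have := rnorm_distD (x m) (hcemb (a m)) (hcemb (a n)).
  have := rnorm_distD y (x m) (hcemb (a n)).
  have := rnorm_distD (x n) y (hcemb (a n)).
  have := xa m; have := xa n; rewrite (rnorm_distC (hcemb _) (x m)).
  rewrite (rnorm_distC y (x n)); lra.
have ca : a \in cauchyp.
  apply/asboolP => e e0; have e4 : 0 < e / 4 by rewrite divr_gt0.
  have [k dk] := d_lt _ e4; exists k => m n km kn.
  have := a_dist m n; have := d_le _ _ km; have := d_le _ _ kn; lra.
pose u := CauchySeq ca.
apply/cvg_ex; exists (hcpi u); apply/cvg_rnormP => e e0.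
have e4 : 0 < e / 4 by rewrite divr_gt0.
have [k dk] := d_lt _ e4.
have /cvg_rnormP/(_ _ e4)[l _ ul] := hcemb_cvg u.
pose n := maxn k l.
have un := ul n (leq_maxr _ _).
have dn := d_le _ _ (leq_maxl k l : (k <= n)%N).
apply: filterS (Fx n) => y /= xy.
have := rnorm_distD (hcemb (a n)) (hcpi u) y.
have := rnorm_distD (x n) (hcemb (a n)) y.
have := xa n; rewrite (rnorm_distC (hcemb _) (x n)).
move: un => /=; lra.
Qed.

HB.instance Definition _ := Uniform_isComplete.Build hc hc_complete.

End HausdorffCompletion.
Arguments sn_cvg {R A N} u _ _.
Arguments hcemb_cvg {R A N} u _ _.


Lemma cvg_rnorm (R : realType) (E : normedModType R[i]) (T : Type)
    (F : set_system T) (FF : Filter F) (f : T -> E) (x : E) :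
  f @ F --> x -> rnorm (f t) @[t --> F] --> rnorm x.
Proof.
move=> /cvg_rnormP fx; apply/cvgrPdist_lt => e e0.
have : F (f @^-1` [set y | rnorm (x - y) < e]) by exact: fx.
apply: filterS => t /=; apply: le_lt_trans.
rewrite ler_norml; apply/andP; split.
  by rewrite lerNl opprB lerBlDr rnorm_distC (le_trans _ (rnormD _ _))// subrK.
by rewrite lerBlDr (le_trans _ (rnormD _ _))// subrK.
Qed.

Section OperatorNorm.
Variables (R : realType) (E : normedModType R[i]).

Definition bounded_operator (T : E -> E) :=
  exists M : R, forall x, rnorm (T x) <= M * rnorm x.

Definition opnorm (T : E -> E) : R :=
  sup [set rnorm (T x) | x in [set x | rnorm x <= 1]].

Lemma opnorm_le (T : E -> E) (M : R) : 0 <= M ->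
  (forall x, rnorm (T x) <= M * rnorm x) -> opnorm T <= M.
Proof.
move=> M0 TM; apply: ge_sup => [|_ [x /= x1 <-]].
  by exists (rnorm (T 0)), 0 => //=; rewrite rnorm0.
by rewrite (le_trans (TM x))// ler_piMr.
Qed.

Lemma le_opnorm (T : {linear E -> E}) : bounded_operator T ->
  forall x, rnorm (T x) <= opnorm T * rnorm x.
Proof.
move=> [M TM] x; have [x0|x0] := eqVneq (rnorm x) 0.
  by rewrite x0 mulr0 (rnorm0_eq0 x0) linear0 rnorm0.
have xp : 0 < rnorm x by rewrite lt_def x0 rnorm_ge0.
have nk : complex.Re `|(rnorm x)^-1%:C : R[i]| = (rnorm x)^-1.
  rewrite ger0_norm ?ler0c ?invr_ge0 ?rnorm_ge0//.
rewrite -ler_pdivrMr// mulrC -nk -rnormZ -linearZ.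
apply: ub_le_sup; last first.
  by exists ((rnorm x)^-1%:C *: x) => //=; rewrite rnormZ nk mulVf.
exists `|M| => _ [y /= y1 <-]; rewrite (le_trans (TM y))//.
rewrite (le_trans (ler_wpM2r (rnorm_ge0 _) (ler_norm M)))//.
by rewrite ler_piMr.
Qed.

Lemma opnorm_ge0 (T : {linear E -> E}) : bounded_operator T -> 0 <= opnorm T.
Proof.
move=> [M TM]; apply: ub_le_sup; last first.
  by exists 0 => /=; rewrite ?linear0 rnorm0.
exists `|M| => _ [y /= y1 <-]; rewrite (le_trans (TM y))//.
rewrite (le_trans (ler_wpM2r (rnorm_ge0 _) (ler_norm M)))//.
by rewrite ler_piMr.
Qed.

End OperatorNorm.

(* rep1 and repM make every rep_op g invertible, with inverse rep_op g^-1. *)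
Record representation (R : realType) (G : groupType) (E : normedModType R[i]) :=
  Representation {
    rep_op :> G -> {linear E -> E};
    rep_bounded : forall g, bounded_operator (rep_op g);
    rep1 : forall x, rep_op 1%g x = x;
    repM : forall g h x, rep_op (g * h)%g x = rep_op g (rep_op h x)
  }.

Section Representation.
Variables (R : realType) (G : groupType) (E : normedModType R[i]).
Variable (pi : representation G E).
Implicit Types (a b : group_algebra R[i] G).

Definition rep_alg a (x : E) : E := lsum a (fun g => pi g x).

Lemma rep_alg_is_linear a : linear (rep_alg a).
Proof.
move=> k x y; rewrite /rep_alg /lsum scaler_sumr -big_split.
by apply: eq_bigr => g _; rewrite linearP/= scalerDr !scalerA mulrC.
Qed.

HB.instance Definition _ a :=
  GRing.isLinear.Build R[i] E E *:%R (rep_alg a) (rep_alg_is_linear a).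

Lemma rep_algD a b x : rep_alg (a + b) x = rep_alg a x + rep_alg b x.
Proof. exact: lsumD. Qed.
Lemma rep_algZ k a x : rep_alg (k *: a) x = k *: rep_alg a x.
Proof. exact: lsumZ. Qed.
Lemma rep_algB a b x : rep_alg (a - b) x = rep_alg a x - rep_alg b x.
Proof. by rewrite -scaleN1r rep_algD rep_algZ scaleN1r. Qed.
Lemma rep_algM a b x : rep_alg (a * b) x = rep_alg a (rep_alg b x).
Proof.
rewrite /rep_alg lsum_lsum; apply: eq_lsum => g.
rewrite lsum_lsum (lsum_linear (pi g)); apply: eq_lsum => h /=.
by rewrite lsum_delta repM.
Qed.
Lemma rep_alg1 x : rep_alg 1 x = x.
Proof. by rewrite /rep_alg lsum_delta rep1. Qed.

Lemma rnorm_sum I (r : seq I) (f : I -> E) :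
  rnorm (\sum_(i <- r) f i) <= \sum_(i <- r) rnorm (f i).
Proof.
elim/big_rec2: _ => [|i x y _ IH]; first by rewrite rnorm0.
by rewrite (le_trans (rnormD _ _))// lerD2l.
Qed.

Lemma rep_alg_le a (M : G -> R) : (forall g x, rnorm (pi g x) <= M g * rnorm x) ->
  forall x, rnorm (rep_alg a x) <=
    (\sum_(g <- finsupp a) complex.Re `|a g| * M g) * rnorm x.
Proof.
move=> piM x; rewrite (le_trans (rnorm_sum _ _))// mulr_suml.
apply: ler_sum => g _; rewrite rnormZ -mulrA ler_wpM2l//.
by rewrite -ler0c (RRe_real (normr_real _)).
Qed.

Lemma rep_alg_bounded a : bounded_operator (rep_alg a).
Proof.
exists (\sum_(g <- finsupp a) complex.Re `|a g| * opnorm (pi g)).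
by apply: rep_alg_le => g; exact/le_opnorm/rep_bounded.
Qed.

Definition invariants : set E := [set x | forall g, pi g x = x].

End Representation.

Definition rep_collection (R : realType) (G : groupType) :=
  forall E : completeNormedModType R[i], representation G E -> Prop.

Section Collection.
Variables (R : realType) (G : groupType) (F : rep_collection R G).
Implicit Types (a b : group_algebra R[i] G).

Definition group_norms (g : G) : set R :=
  [set r | exists (E : completeNormedModType R[i]) (pi : representation G E),
     F pi /\ r = opnorm (pi g)].

Definition alg_norms a : set R :=
  [set r | exists (E : completeNormedModType R[i]) (pi : representation G E),
     F pi /\ r = opnorm (rep_alg pi a)].

(* sup set0 = 0, so that the seminorm of the empty collection is 0. *)
Definition F_norm a : R := sup (alg_norms a).

Definition pointwise_bounded := forall g, has_ubound (group_norms g).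

Hypothesis Fb : pointwise_bounded.

Lemma alg_norms_ubound a : has_ubound (alg_norms a).
Proof.
have /choice[M FM] := Fb.
exists (\sum_(g <- finsupp a) complex.Re `|a g| * `|M g|) => _ [E [pi [Fpi ->]]].
apply: opnorm_le.
  apply: sumr_ge0 => g _; rewrite mulr_ge0//.
  by rewrite -ler0c (RRe_real (normr_real _)).
apply: rep_alg_le => g x.
rewrite (le_trans (le_opnorm (rep_bounded pi g) x))// ler_wpM2r ?rnorm_ge0//.
by rewrite (le_trans _ (ler_norm _))// FM//; exists E, pi.
Qed.

Lemma le_F_norm a (E : completeNormedModType R[i]) (pi : representation G E) :
  F pi -> opnorm (rep_alg pi a) <= F_norm a.
Proof.
by move=> Fpi; apply: ub_le_sup; [exact: alg_norms_ubound|exists E, pi].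
Qed.

Lemma F_norm_le a (M : R) : 0 <= M ->
  (forall (E : completeNormedModType R[i]) (pi : representation G E), F pi ->
     opnorm (rep_alg pi a) <= M) -> F_norm a <= M.
Proof.
move=> M0 aM; have [n0|/set0P ne] := eqVneq (alg_norms a) set0.
  by rewrite /F_norm n0 sup0.
by apply: ge_sup => // _ [E [pi [Fpi ->]]]; exact: aM.
Qed.

Lemma F_norm_ge0 a : 0 <= F_norm a.
Proof.
have [n0|/set0P[_ [E [pi [Fpi _]]]]] := eqVneq (alg_norms a) set0.
  by rewrite /F_norm n0 sup0.
rewrite (le_trans _ (le_F_norm a Fpi))//.
exact/opnorm_ge0/rep_alg_bounded.
Qed.

Lemma rep_alg_F_norm a (E : completeNormedModType R[i])
    (pi : representation G E) x :
  F pi -> rnorm (rep_alg pi a x) <= F_norm a * rnorm x.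
Proof.
move=> Fpi; rewrite (le_trans (le_opnorm (rep_alg_bounded pi a) x))//.
by rewrite ler_wpM2r ?rnorm_ge0// le_F_norm.
Qed.

Fact F_normD a b : F_norm (a + b) <= F_norm a + F_norm b.
Proof.
apply: F_norm_le => [|E pi Fpi]; first by rewrite addr_ge0 ?F_norm_ge0.
apply: opnorm_le => [|x]; first by rewrite addr_ge0 ?F_norm_ge0.
rewrite rep_algD mulrDl (le_trans (rnormD _ _))// lerD//;
  exact: rep_alg_F_norm.
Qed.

Lemma F_normZ_le k a : F_norm (k *: a) <= complex.Re `|k| * F_norm a.
Proof.
have ka : 0 <= complex.Re `|k| * F_norm a.
  by rewrite mulr_ge0 ?F_norm_ge0 ?Re_norm_ge0.
apply: F_norm_le => // E pi Fpi; apply: opnorm_le => // x.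
rewrite rep_algZ rnormZ -mulrA ler_wpM2l ?Re_norm_ge0//.
exact: rep_alg_F_norm.
Qed.

Fact F_normZ k a : F_norm (k *: a) = complex.Re `|k| * F_norm a.
Proof.
apply/eqP; rewrite eq_le F_normZ_le andTb.
have [->|k0] := eqVneq k 0; first by rewrite normr0 mul0r F_norm_ge0.
have kp : 0 < complex.Re `|k|.
  by rewrite -real_complex_gt0 (RRe_real (normr_real _)) normr_gt0.
rewrite -ler_pdivlMl//; have := F_normZ_le k^-1 (k *: a).
rewrite scalerA mulVf// scale1r.
suff -> : complex.Re `|k^-1| = (complex.Re `|k|)^-1 by [].
apply: (@complexI R); rewrite fmorphV (RRe_real (normr_real _)) normfV.
by congr (_^-1); rewrite (RRe_real (normr_real _)).
Qed.

Fact F_normM a b : F_norm (a * b) <= F_norm a * F_norm b.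
Proof.
have ab : 0 <= F_norm a * F_norm b by rewrite mulr_ge0 ?F_norm_ge0.
apply: F_norm_le => // E pi Fpi; apply: opnorm_le => // x.
rewrite rep_algM (le_trans (rep_alg_F_norm _ _ Fpi))// -mulrA.
by rewrite ler_wpM2l ?F_norm_ge0 ?rep_alg_F_norm.
Qed.

Definition F_seminorm : alg_seminorm (group_algebra R[i] G) :=
  AlgSeminorm F_normD F_normZ F_normM.

End Collection.

(* The Banach algebra C_F(G). *)
Notation CF Fb := (hcompletion (F_seminorm Fb)).

Section Extension.
Variables (R : realType) (G : groupType) (F : rep_collection R G).
Variable (Fb : pointwise_bounded F).
Local Notation CF := (CF Fb).

Definition CF_emb (a : group_algebra R[i] G) : CF := hcemb (F_seminorm Fb) a.

Section One.
Variables (E : completeNormedModType R[i]) (pi : representation G E).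

(* The extension of pi to the completion. For pi in F the limit exists and does
   not depend on the Cauchy sequence representing p (CF_repE), CF_rep extends
   rep_alg (CF_rep_emb), is multiplicative, and has norm at most that of p. *)
Definition CF_rep (p : CF) (x : E) : E :=
  lim (rep_alg pi (repr p n) x @[n --> \oo]).

Hypothesis Fpi : F pi.

Lemma rep_alg_cvg (u : cauchy_seq (F_seminorm Fb)) x :
  cvg (rep_alg pi (u n) x @[n --> \oo]).
Proof.
apply/cauchy_cvgP/cauchy_exP => e e0.
have er : (complex.Re e)%:C = e by rewrite RRe_real// gtr0_real.
have x1 : 0 < rnorm x + 1 by rewrite ltr_wpDl ?rnorm_ge0.
have {}e0 : 0 < complex.Re e by rewrite -real_complex_gt0 er.
have [k uk] := cseqP u (divr_gt0 e0 x1).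
exists (rep_alg pi (u k) x), k => // n /= kn; rewrite -ball_normE /=.
rewrite -rnormE -er ltcR -rep_algB (le_lt_trans (rep_alg_F_norm Fb _ _ Fpi))//.
have := uk _ _ (leqnn k) kn; rewrite ltr_pdivlMr//; apply: le_lt_trans.
by rewrite ler_wpM2l ?F_norm_ge0// lerDl.
Qed.

Lemma CF_repE (u : cauchy_seq (F_seminorm Fb)) x :
  rep_alg pi (u n) x @[n --> \oo] --> CF_rep (hcpi u) x.
Proof.
have vc : rep_alg pi (repr (hcpi u) n) x @[n --> \oo] --> CF_rep (hcpi u) x.
  exact: rep_alg_cvg.
have /asboolP nu := repr_hcpi u.
rewrite (_ : (fun n => rep_alg pi (u n) x) = (fun n =>
  rep_alg pi (repr (hcpi u) n) x - rep_alg pi ((repr (hcpi u) - u) n) x)); last first.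
  by apply/funext => n; rewrite cseqD cseqN rep_algB subKr.
rewrite -[X in _ --> X]subr0; apply: cvgB => //.
apply/cvg_rnormP => e e0.
have x1 : 0 < rnorm x + 1 by rewrite ltr_wpDl ?rnorm_ge0.
have [k uk] := nu _ (divr_gt0 e0 x1); exists k => // n kn /=.
rewrite sub0r rnormN (le_lt_trans (rep_alg_F_norm Fb _ _ Fpi))//.
have := uk _ kn; rewrite ltr_pdivlMr//; apply: le_lt_trans.
by rewrite ler_wpM2l ?F_norm_ge0// lerDl.
Qed.

Arguments CF_repE : clear implicits.

Lemma CF_rep_lim (u : cauchy_seq (F_seminorm Fb)) x :
  CF_rep (hcpi u) x = lim (rep_alg pi (u n) x @[n --> \oo]).
Proof. by apply/esym/(cvg_lim (@norm_hausdorff _ _))/CF_repE. Qed.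

Lemma CF_rep_emb a x : CF_rep (CF_emb a) x = rep_alg pi a x.
Proof.
rewrite CF_rep_lim -[LHS]/(lim (rep_alg pi a x @[n --> \oo])).
by rewrite lim_cst//; exact: norm_hausdorff.
Qed.

Lemma CF_rep_is_linear p : linear (CF_rep p).
Proof.
move=> k x y; rewrite -[p]hcpi_repr CF_rep_lim.
apply: (cvg_lim (@norm_hausdorff _ _)).
under eq_fun do rewrite linearP.
by apply: cvgD; [apply: cvgZl_tmp|]; exact: CF_repE.
Qed.

Lemma CF_repD p q x : CF_rep (p + q) x = CF_rep p x + CF_rep q x.
Proof.
rewrite -[p]hcpi_repr -[q]hcpi_repr -hcpiD CF_rep_lim.
apply: (cvg_lim (@norm_hausdorff _ _)).
under eq_fun do rewrite cseqD rep_algD.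
by apply: cvgD; exact: CF_repE.
Qed.

Lemma CF_repZ k p x : CF_rep (k *: p) x = k *: CF_rep p x.
Proof.
rewrite -[p]hcpi_repr -hcpiZ CF_rep_lim.
apply: (cvg_lim (@norm_hausdorff _ _)).
under eq_fun do rewrite cseqZ rep_algZ.
by apply: cvgZl_tmp; exact: CF_repE.
Qed.

Lemma CF_rep_le p x : rnorm (CF_rep p x) <= rnorm p * rnorm x.
Proof.
rewrite -[p]hcpi_repr; set u := repr p.
rewrite rnorm_hcpi.
have h1 : rnorm (rep_alg pi (u n) x) @[n --> \oo] --> rnorm (CF_rep (hcpi u) x).
  by apply: cvg_rnorm; exact: CF_repE.
have h2 : F_seminorm Fb (u n) * rnorm x @[n --> \oo] --> sn_lim u * rnorm x.
  by apply: cvgM; [exact: sn_cvg|exact: cvg_cst].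
apply: ler_cvg_to h1 h2 _.
by apply: nearW => n; exact: rep_alg_F_norm.
Qed.

Lemma CF_rep_continuous p : continuous (CF_rep p).
Proof.
move=> x; apply/cvg_rnormP => e e0.
have p1 : 0 < rnorm p + 1 by rewrite ltr_wpDl ?rnorm_ge0.
have /cvg_rnormP/(_ _ (divr_gt0 e0 p1)) : nbhs x --> x by exact: cvg_id.
apply: filterS => y; rewrite ltr_pdivlMr// mulrC; apply: le_lt_trans.
have -> : CF_rep p x - CF_rep p y = CF_rep p (x - y).
  by rewrite addrC -scaleN1r -CF_rep_is_linear scaleN1r addrC.
by rewrite (le_trans (CF_rep_le _ _))// ler_wpM2r ?rnorm_ge0// lerDl.
Qed.

Lemma CF_repM p q x : CF_rep (p * q) x = CF_rep p (CF_rep q x).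
Proof.
rewrite -[p]hcpi_repr -[q]hcpi_repr -hcpiM; set u := repr p; set v := repr q.
rewrite CF_rep_lim; apply: (cvg_lim (@norm_hausdorff _ _)).
have [M M0 uM] := sn_cauchy_bounded (cseqP u).
have Mn0 : M != 0 by rewrite gt_eqF.
apply/cvg_rnormP => e e0; have e2 : 0 < e / 2 by rewrite divr_gt0.
have /cvg_rnormP/(_ _ e2)[k _ uk] := CF_repE u (CF_rep (hcpi v) x).
have /cvg_rnormP/(_ _ (divr_gt0 e2 M0))[l _ vl] := CF_repE v x.
exists (maxn k l) => // n /=; rewrite geq_max => /andP[/uk/= un /vl/= vn].
rewrite rep_algM.
have := rnorm_distD (rep_alg pi (u n) (CF_rep (hcpi v) x))
  (CF_rep (hcpi u) (CF_rep (hcpi v) x)) (rep_alg pi (u n) (rep_alg pi (v n) x)).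
rewrite -[rep_alg pi (u n) _ - _]linearB.
have := rep_alg_F_norm Fb (u n) (CF_rep (hcpi v) x - rep_alg pi (v n) x) Fpi.
have := ler_wpM2r (rnorm_ge0 (CF_rep (hcpi v) x - rep_alg pi (v n) x)) (uM n).
move: vn; rewrite ltr_pdivlMr// mulrC => vn h1 h2 h3.
have {h1}h2 := le_trans h2 h1; lra.
Qed.

End One.
End Extension.
Arguments CF_repE {R G F Fb E pi} _ u x _ _.

Definition symmetric_set (G : groupType) (S : {fset G}) :=
  forall s, s \in S -> s^-1%g \in S.

Definition subgroup (G : groupType) (H : set G) :=
  [/\ H 1%g, (forall g h, H g -> H h -> H (g * h)%g)
    & (forall g, H g -> H g^-1%g)].

Definition generates (G : groupType) (S : {fset G}) :=
  forall H : set G, subgroup H -> [set` S] `<=` H -> H = setT.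

Lemma pointwise_bounded_gen (R : realType) (G : groupType) (S : {fset G})
    (F : rep_collection R G) :
  symmetric_set S -> generates S ->
  (forall g, g \in S -> has_ubound (group_norms F g)) -> pointwise_bounded F.
Proof.
move=> symS genS bS.
pose B g := has_ubound (group_norms F g).
have bM g h : B g -> B h -> B (g * h)%g.
  move=> [M gM] [L hL]; exists (`|M| * `|L|) => _ [E [pi [Fpi ->]]].
  apply: opnorm_le => [|x]; first by rewrite mulr_ge0.
  have Mg : opnorm (pi g) <= `|M|.
    by rewrite (le_trans _ (ler_norm M))// gM//; exists E, pi.
  have Lh : opnorm (pi h) <= `|L|.
    by rewrite (le_trans _ (ler_norm L))// hL//; exists E, pi.
  rewrite repM (le_trans (le_opnorm (rep_bounded pi g) _))// -mulrA.
  apply: ler_pM => //; rewrite ?rnorm_ge0//.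
    exact/opnorm_ge0/rep_bounded.
  rewrite (le_trans (le_opnorm (rep_bounded pi h) _))//.
  by rewrite ler_wpM2r ?rnorm_ge0.
pose H := [set g | B g /\ B g^-1%g].
have sH : subgroup H.
  split=> [|g h [bg bg'] [bh bh']|g [bg bg']].
  - suff B1 : B 1%g by split => //; rewrite invg1.
    exists 1 => _ [E [pi [Fpi ->]]]; apply: opnorm_le => // x.
    by rewrite rep1 mul1r.
  - by split; [exact: bM|rewrite invgM; exact: bM].
  - by split => //; rewrite invgK.
have HT : H = setT.
  by apply: genS => // s Ss; split; apply: bS => //; exact: symS.
by move=> g; have [] : H g by rewrite HT.
Qed.

Section Displacement.
Variables (R : realType) (G : groupType) (E : normedModType R[i]).

(* Norms are nonnegative, so the unit 0 only matters when S is empty. *)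
Definition displacement (S : {fset G}) (act : G -> E -> E) (x : E) : R :=
  \big[Num.max/0]_(s <- S) rnorm (act s x - x).

End Displacement.

Record affine_action (R : realType) (G : groupType) (E : normedModType R[i])
    (pi : representation G E) := AffineAction {
  cocycle : G -> E;
  cocycleM : forall g h, cocycle (g * h)%g = cocycle g + pi g (cocycle h)
}.

Definition aff_op (R : realType) (G : groupType) (E : normedModType R[i])
    (pi : representation G E) (sigma : affine_action pi) (g : G) (x : E) : E :=
  pi g x + cocycle sigma g.
Coercion aff_op : affine_action >-> Funclass.

(* Meaningful when the coefficients of m sum to 1. *)
Definition aff_alg (R : realType) (G : groupType) (E : normedModType R[i])
    (pi : representation G E) (sigma : affine_action pi)
    (m : group_algebra R[i] G) (x : E) : E :=
  lsum m (fun g => sigma g x).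

Definition projection_onto (R : realType) (E : normedModType R[i])
    (P : E -> E) (V : set E) :=
  [/\ linear P, continuous P, (forall x, P (P x) = P x) & range P = V].

Definition kazhdan_projection (R : realType) (G : groupType)
    (F : rep_collection R G) (Fb : pointwise_bounded F) (p : CF Fb) :=
  [/\ p * p = p,
      closure [set CF_emb Fb m | m in [set m | augmentation m = 1]] p
    & forall (E : completeNormedModType R[i]) (pi : representation G E),
        F E pi -> projection_onto (CF_rep pi p) (invariants pi)].

Definition contracts_displacement (R : realType) (G : groupType) (S : {fset G})
    (F : rep_collection R G) (m : group_algebra R[i] G) :=
  forall (E : completeNormedModType R[i]) (pi : representation G E), F E pi ->
    forall x : E, displacement S (fun g => pi g) (rep_alg pi m x)
                  <= 2^-1 * displacement S (fun g => pi g) x.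

(* Main.v *)
Require Import Defs.
From mathcomp Require Import all_boot all_order all_algebra finmap.
From mathcomp Require Import boolp classical_sets reals topology normedtype complex.
From mathcomp Require Import interval_inference sequences lra.

Set Implicit Arguments.
Unset Strict Implicit.
Unset Printing Implicit Defensive.

Import Order.TTheory GRing.Theory Num.Theory.
Import numFieldNormedType.Exports.
Local Open Scope classical_set_scope.
Local Open Scope ring_scope.

(** Write [delta] for the displacement. Since [S] generates [G], for every [m] of
    augmentation [1] there is a constant [C], uniform over [F] and valid for affine
    actions as well, with [|sigma(m) x - x| <= C * delta x].

    If [delta (pi(m) x) <= delta x / 2], then [|m^(n+1) - m^n|] decays geometrically
    in [C_F(G)], so [m^n] converges to some [p], and [pi(p) x] has displacement [0].
    The same iteration, run on an affine action, converges to a fixed point.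

    Conversely, let [p] be a Kazhdan projection and put [y = x - pi(p) x], so that
    [pi(p) y = 0] and [delta y = delta x]. For a fixed [m0] of augmentation [1] with
    [|m0 - p| <= 1/2] we get [|y| <= 2 |y - pi(m0) y| <= 2 C delta x], and for
    [m] close to [p] the displacement of [pi(m) x] is that of
    [pi(m) y = pi(m - p) y], which is at most [L * |m - p| * |y|]. *)

(** * Geometric decay and Cauchy sequences *)

Section GeometricDecay.
Variable R : realType.

Lemma geometric_small (C e : R) : 0 < e ->
  exists k, forall n, (k <= n)%N -> C * 2^-1 ^+ n < e.
Proof.
move=> e0.
have h : `|2^-1 : R| < 1 by rewrite ger0_norm ?invr_ge0// invf_lt1// ltr1n.
have /cvgrPdist_lt/(_ e e0)[k _ uk] := cvg_geometric C h.
exists k => n kn; have := uk n kn; rewrite /= /geometric/= sub0r normrN.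
by apply: le_lt_trans; exact: ler_norm.
Qed.

(** Summing the steps gives a geometric tail: [C * 2^-m] plus the bound [2 * C * 2^-(m+1)] for the
    rest is again [2 * C * 2^-m]. Leaving [d] abstract covers both the norm of [E] and the seminorm
    on the group algebra. *)
Lemma geometric_chain (d : nat -> nat -> R) (C : R) :
  0 <= C -> (forall n, d n n = 0) ->
  (forall i j k, d i k <= d i j + d j k) ->
  (forall n, d n n.+1 <= C * 2^-1 ^+ n) ->
  forall m n, (m <= n)%N -> d m n <= 2 * C * 2^-1 ^+ m.
Proof.
move=> C0 dnn dD dS m n /subnKC <-; move: (n - m)%N => k.
have C2 l : 0 <= C * 2^-1 ^+ l by rewrite mulr_ge0// exprn_ge0// invr_ge0.
elim: k m => [|k IH] m.
  by rewrite addn0 dnn -mulrA mulr_ge0.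
rewrite addnS -addSn (le_trans (dD _ m.+1 _))//.
have := dS m; have := IH m.+1; rewrite exprS; have := C2 m.
by rewrite !mulrA; lra.
Qed.

Lemma geometric_cauchy_cvg (E : completeNormedModType R[i]) (y : nat -> E) (C : R) :
  0 <= C -> (forall n, rnorm (y n - y n.+1) <= C * 2^-1 ^+ n) ->
  cvg (y n @[n --> \oo]).
Proof.
move=> C0 yS; apply/cauchy_cvgP/cauchy_exP => e e0.
have er : (complex.Re e)%:C%C = e by rewrite RRe_real// gtr0_real.
have {}e0 : 0 < complex.Re e by rewrite -real_complex_gt0 er.
have [k uk] := geometric_small (2 * C) e0.
exists (y k), k => // n /= kn; rewrite -ball_normE /= -rnormE -er ltcR.
apply: le_lt_trans (uk k (leqnn k)).
apply: (@geometric_chain (fun i j => rnorm (y i - y j))) => //.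
- by move=> i; rewrite subrr rnorm0.
- by move=> i j l; exact: rnorm_distD.
Qed.

End GeometricDecay.

(** * Multiplicativity of the augmentation *)

Section Augmentation.
Variables (K : comNzRingType) (G : groupType).
Implicit Types a b : group_algebra K G.

(** This form lets the convolution rules for [lsum] apply to the augmentation. *)
Lemma augmentationE a : augmentation a = lsum a (fun=> 1 : K^o).
Proof. by apply: eq_bigr => g _; rewrite /GRing.scale/= mulr1. Qed.

Lemma lsum_cst (V : lmodType K) a (x : V) : lsum a (fun=> x) = augmentation a *: x.
Proof. by rewrite scaler_suml. Qed.

Lemma augmentationM a b : augmentation (a * b) = augmentation a * augmentation b.
Proof.
rewrite !augmentationE lsum_lsum.
under eq_lsum do rewrite lsum_lsum.
under eq_lsum do under eq_lsum do rewrite lsum_delta.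
by rewrite lsum_cst -!augmentationE.
Qed.

Lemma augmentation_expr a n : augmentation a = 1 -> augmentation (a ^+ n) = 1.
Proof.
move=> a1; elim: n => [|n IH]; last by rewrite exprS augmentationM a1 IH mulr1.
by rewrite expr0 augmentationE lsum_delta.
Qed.

End Augmentation.

(** * Elementary bounds on displacement *)

Section DisplacementTheory.
Variables (R : realType) (G : groupType) (E : normedModType R[i]).
Variables (S : {fset G}).
Implicit Types act : G -> E -> E.

Lemma displacement_ge0 act x : 0 <= displacement S act x.
Proof.
rewrite /displacement; elim/big_rec: _ => // s y _ y0.
by rewrite le_max y0 orbT.
Qed.

Lemma le_displacement act x s : s \in S -> rnorm (act s x - x) <= displacement S act x.
Proof. by move=> sS; rewrite /displacement; exact: (@le_bigmax_seq _ _ _ _ _ s). Qed.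

Lemma displacement_le act x (M : R) : 0 <= M ->
  (forall s, s \in S -> rnorm (act s x - x) <= M) -> displacement S act x <= M.
Proof.
move=> M0 aM; rewrite /displacement big_seq_cond.
by apply: bigmax_le => // s /andP[sS _]; exact: aM.
Qed.

Lemma eq_displacement act act' x y :
  (forall s, act s x - x = act' s y - y) -> displacement S act x = displacement S act' y.
Proof. by move=> e; apply: eq_bigr => s _; rewrite e. Qed.

End DisplacementTheory.

(** * Affine actions and their linear parts *)

Section Affine.
Variables (R : realType) (G : groupType) (E : normedModType R[i]).
Variables (pi : representation G E).
Implicit Types sigma : affine_action pi.

Fact zero_cocycleM (g h : G) : (0 : E) = 0 + pi g 0.
Proof. by rewrite linear0 addr0. Qed.

(** Estimates proved once for affine actions specialize through this zero cocycle to linear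
    representations. *)
Definition linear_action : affine_action pi := AffineAction (cocycle := fun=> 0) zero_cocycleM.

Lemma linear_actionE g x : linear_action g x = pi g x.
Proof. exact: addr0. Qed.

Lemma displacement_linear_action S x :
  displacement S linear_action x = displacement S (fun g => pi g) x.
Proof. by apply: eq_displacement => s; rewrite linear_actionE. Qed.

Lemma aff_alg_linear_action m x : aff_alg linear_action m x = rep_alg pi m x.
Proof. by apply: eq_lsum => g; exact: linear_actionE. Qed.

Lemma aff_opB sigma g x y : sigma g x - sigma g y = pi g (x - y).
Proof. by rewrite /aff_op linearB opprD addrACA subrr addr0. Qed.

Lemma aff_opM sigma g h x : sigma (g * h)%g x = sigma g (sigma h x).
Proof. by rewrite /aff_op repM cocycleM linearD -addrA [pi g _ + cocycle _ _]addrC. Qed.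

Lemma aff_op1 sigma x : sigma 1%g x = x.
Proof.
have : cocycle sigma 1%g = 0.
  have := cocycleM sigma 1%g 1%g; rewrite mulg1 rep1 => /eqP.
  by rewrite -subr_eq0 opprD addNKr oppr_eq0 => /eqP.
by rewrite /aff_op rep1 => ->; rewrite addr0.
Qed.

Lemma aff_algB sigma m x : augmentation m = 1 ->
  aff_alg sigma m x - x = lsum m (fun g => sigma g x - x).
Proof. by move=> m1; rewrite lsumDf lsum_cst m1 scale1r. Qed.

(** A fixed point taken as origin makes the action linear: each term becomes
    [sigma g x - sigma g x0 = pi g (x - x0)], the augmentation letting [x0] be spread over the
    sum. *)
Lemma aff_alg_fixed sigma m x0 x : augmentation m = 1 ->
  (forall g, sigma g x0 = x0) -> aff_alg sigma m x - x0 = rep_alg pi m (x - x0).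
Proof.
move=> m1 fx0; rewrite -[x0 in LHS]scale1r -m1 -scalerN -lsum_cst -lsumDf.
by apply: eq_lsum => g; rewrite -[X in _ - X](fx0 g) aff_opB.
Qed.

Lemma rep_alg_invariant m x : augmentation m = 1 -> invariants pi x -> rep_alg pi m x = x.
Proof.
move=> m1 px; rewrite /rep_alg (eq_lsum _ (h := fun=> x)) ?lsum_cst ?m1 ?scale1r//.
Qed.

End Affine.

(** * Estimates uniform over the collection *)

Section UniformBounds.
Variables (R : realType) (G : groupType) (S : {fset G}) (F : rep_collection R G).
Hypotheses (genS : generates S) (Fb : Defs.pointwise_bounded F).

Lemma rep_uniform_bound : exists2 K : G -> R, (forall g, 0 <= K g) &
  forall (E : completeNormedModType R[i]) (pi : representation G E), F pi ->
  forall g x, rnorm (pi g x) <= K g * rnorm x.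
Proof.
have /choice[M FM] := Fb.
(* If [F] is empty, the upper bound [M g] may be negative; hence the absolute value. *)
exists (fun g => `|M g|) => // E pi Fpi g x.
rewrite (le_trans (le_opnorm (rep_bounded pi g) x))// ler_wpM2r ?rnorm_ge0//.
by rewrite (le_trans _ (ler_norm _))// FM//; exists E, pi.
Qed.

(** The cocycle cancels in differences: [sigma s x - x] and [sigma s y - y] differ by
    [pi s (x - y) - (x - y)]. *)
Lemma displacement_lipschitz : exists2 L : R, 0 <= L &
  forall (E : completeNormedModType R[i]) (pi : representation G E)
    (sigma : affine_action pi), F pi -> forall x y : E,
  displacement S sigma x <= displacement S sigma y + L * rnorm (x - y).
Proof.
have [K K0 FK] := rep_uniform_bound.
have L0 : 0 <= 1 + \sum_(s <- S) K s by rewrite addr_ge0// sumr_ge0.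
(* The [1] pays for [x - y]; the sum dominates every [K s] with [s] in [S]. *)
exists (1 + \sum_(s <- S) K s) => // E pi sigma Fpi x y.
apply: displacement_le => [|s sS].
  by rewrite addr_ge0 ?displacement_ge0 ?mulr_ge0 ?rnorm_ge0.
have Ks : K s <= \sum_(s <- S) K s.
  by rewrite (big_fsetD1 s)//= lerDl sumr_ge0.
have -> : sigma s x - x = (sigma s y - y) + (pi s (x - y) - (x - y)).
  rewrite -(aff_opB sigma) opprB addrA [sigma s y - y + _]addrC.
  by rewrite !subrKA.
rewrite (le_trans (rnormD _ _))// lerD ?le_displacement//.
rewrite (le_trans (rnormD _ _))// rnormN mulrDl mul1r addrC lerD2l.
by rewrite (le_trans (FK _ _ Fpi _ _))// ler_wpM2r ?rnorm_ge0.
Qed.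

(** The Lipschitz bound is compared with the origin, which a linear action does not move. *)
Lemma displacement_le_norm : exists2 L : R, 0 <= L &
  forall (E : completeNormedModType R[i]) (pi : representation G E), F pi ->
  forall x : E, displacement S (fun g => pi g) x <= L * rnorm x.
Proof.
have [L L0 FL] := displacement_lipschitz.
exists L => // E pi Fpi x; have := FL E pi (linear_action pi) Fpi x 0.
rewrite !displacement_linear_action subr0 => /le_trans; apply.
rewrite gerDr; apply: displacement_le => // s _.
by rewrite linear0 subr0 rnorm0.
Qed.

(** The elements [g] admitting a constant independent of [E], [pi] and [sigma] form a subgroup
    containing [S], hence all of [G]. For products, [sigma (g * h) x - x] splits as
    [pi g (sigma h x - x) + (sigma g x - x)]. *)
Lemma op_move_le_displacement : exists2 C : G -> R, (forall g, 0 <= C g) &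
  forall g (E : completeNormedModType R[i]) (pi : representation G E)
    (sigma : affine_action pi), F pi -> forall x : E,
  rnorm (sigma g x - x) <= C g * displacement S sigma x.
Proof.
have [K K0 FK] := rep_uniform_bound.
pose H := [set g | exists C : R, 0 <= C /\
  forall (E : completeNormedModType R[i]) (pi : representation G E)
    (sigma : affine_action pi), F pi -> forall x : E,
  rnorm (sigma g x - x) <= C * displacement S sigma x].
suff HT : H = setT.
  have /choice[C FC] : forall g, H g by rewrite HT.
  by exists C => g; have [] := FC g.
apply: genS => [|s /= sS]; last first.
  by exists 1; split => // E pi sigma _ x; rewrite mul1r le_displacement.
split=> [|g h [C [C0 FC]] [D [D0 FD]]|g [C [C0 FC]]].
- exists 0; split => // E pi sigma _ x.
  by rewrite aff_op1 subrr rnorm0 mul0r.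
- exists (K g * D + C); split => [|E pi sigma Fpi x].
    by rewrite addr_ge0// mulr_ge0.
  rewrite aff_opM (le_trans (rnorm_distD (sigma g x) _ _))// mulrDl lerD//.
    rewrite aff_opB (le_trans (FK _ _ Fpi _ _))// -mulrA ler_wpM2l//.
    exact: FD.
  exact: FC.
- exists (K g^-1%g * C); split => [|E pi sigma Fpi x]; first by rewrite mulr_ge0.
  have {2}-> : x = sigma g^-1%g (sigma g x) by rewrite -aff_opM mulVg aff_op1.
  rewrite aff_opB (le_trans (FK _ _ Fpi _ _))// -mulrA ler_wpM2l//.
  by rewrite rnorm_distC; exact: FC.
Qed.

Lemma alg_move_le_displacement m : augmentation m = 1 -> exists2 C : R, 0 <= C &
  forall (E : completeNormedModType R[i]) (pi : representation G E)
    (sigma : affine_action pi), F pi -> forall x : E,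
  rnorm (x - aff_alg sigma m x) <= C * displacement S sigma x.
Proof.
move=> m1; have [C C0 FC] := op_move_le_displacement.
exists (\sum_(g <- finsupp m) complex.Re `|m g| * C g) => [|E pi sigma Fpi x].
  by apply: sumr_ge0 => g _; rewrite mulr_ge0 ?Re_norm_ge0.
rewrite rnorm_distC aff_algB// (le_trans (rnorm_sum _ _))// mulr_suml.
apply: ler_sum => g _; rewrite rnormZ -mulrA ler_wpM2l ?Re_norm_ge0//.
exact: FC.
Qed.

Lemma displacement0_fixed (E : completeNormedModType R[i]) (pi : representation G E)
    (sigma : affine_action pi) (x : E) : F pi ->
  displacement S sigma x = 0 -> forall g, sigma g x = x.
Proof.
move=> Fpi x0 g; have [C _ FC] := op_move_le_displacement.
have := FC g E pi sigma Fpi x; rewrite x0 mulr0 => h.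
apply/subr0_eq/rnorm0_eq0/eqP.
by rewrite eq_le h rnorm_ge0.
Qed.

(** Displacement is Lipschitz, so it vanishes at the limit, and a point of zero displacement is
    fixed by the group that [S] generates. *)
Lemma cvg_displacement_fixed (E : completeNormedModType R[i])
    (pi : representation G E) (sigma : affine_action pi) (y : nat -> E) (z : E) (D : R) :
  F pi -> y n @[n --> \oo] --> z ->
  (forall n, displacement S sigma (y n) <= D * 2^-1 ^+ n) ->
  forall g, sigma g z = z.
Proof.
move=> Fpi yz yD; apply: displacement0_fixed => //.
have [L L0 FL] := displacement_lipschitz.
apply/eqP; rewrite eq_le displacement_ge0 andbT; apply/ler_addgt0Pl => e e0.
rewrite addr0; have e2 : 0 < e / 2 by rewrite divr_gt0.
(* Dividing by [L + 1] stays legitimate when [L] is zero. *)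
have L1 : 0 < L + 1 by rewrite ltr_wpDl.
have /cvg_rnormP/(_ _ (divr_gt0 e2 L1))[k _ yk] := yz.
have [l Dl] := geometric_small D e2.
have /= := yk (maxn k l) (leq_maxl _ _); have := Dl (maxn k l) (leq_maxr _ _).
move: (maxn k l) => n Dn; rewrite ltr_pdivlMr// => yn.
have := FL E pi sigma Fpi z (y n); have := yD n.
have := rnorm_ge0 (z - y n); nra.
Qed.

(** The orbit of [0] under [sigma(m)] has geometrically decaying displacement, which also bounds its
    successive steps; completeness provides the limit. *)
Lemma affine_contraction_fixed_point m (E : completeNormedModType R[i])
    (pi : representation G E) (sigma : affine_action pi) :
  augmentation m = 1 -> F pi ->
  (forall x : E, displacement S sigma (aff_alg sigma m x)
                 <= 2^-1 * displacement S sigma x) ->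
  exists x : E, forall g, sigma g x = x.
Proof.
move=> m1 Fpi mS; have [C C0 FC] := alg_move_le_displacement m1.
pose y n := iter n (aff_alg sigma m) (0 : E).
pose D := displacement S sigma (y 0%N).
have yD n : displacement S sigma (y n) <= D * 2^-1 ^+ n.
  elim: n => [|n IH]; first by rewrite expr0 mulr1.
  by rewrite (le_trans (mS _))// exprS mulrCA ler_wpM2l.
have CD0 : 0 <= C * D by rewrite mulr_ge0// displacement_ge0.
have yS n : rnorm (y n - y n.+1) <= C * D * 2^-1 ^+ n.
  by rewrite (le_trans (FC _ _ sigma Fpi (y n)))// -mulrA ler_wpM2l.
exists (lim (y n @[n --> \oo])).
by apply: cvg_displacement_fixed yD => //; exact: geometric_cauchy_cvg CD0 yS.
Qed.

End UniformBounds.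

(** * From a contracting element to a Kazhdan projection *)

Section ContractionToProjection.
Variables (R : realType) (G : groupType) (S : {fset G}) (F : rep_collection R G).
Hypotheses (genS : generates S) (Fb : Defs.pointwise_bounded F).
Variable m : group_algebra R[i] G.
Hypotheses (m1 : augmentation m = 1) (mS : contracts_displacement S F m).

Lemma displacement_rep_alg_expr (E : completeNormedModType R[i])
    (pi : representation G E) n x : F pi ->
  displacement S (fun g => pi g) (rep_alg pi (m ^+ n) x)
  <= displacement S (fun g => pi g) x * 2^-1 ^+ n.
Proof.
move=> Fpi; elim: n => [|n IH]; first by rewrite !expr0 rep_alg1 mulr1.
by rewrite exprS rep_algM (le_trans (mS Fpi _))// exprS mulrCA ler_wpM2l.
Qed.

(** The difference is the move of [pi(m^n) x] under [pi(m)], at most [C] times its displacement;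
    that displacement is at most [L * 2^-n] times the norm of [x]. *)
Lemma F_norm_expr_step : exists2 C : R, 0 <= C &
  forall n, F_norm F (m ^+ n - m ^+ n.+1) <= C * 2^-1 ^+ n.
Proof.
have [C C0 FC] := alg_move_le_displacement genS Fb m1.
have [L L0 FL] := displacement_le_norm S Fb.
exists (C * L) => [|n]; first exact: mulr_ge0.
have CLn : 0 <= C * L * 2^-1 ^+ n by rewrite !mulr_ge0// exprn_ge0// invr_ge0.
apply: F_norm_le => // E pi Fpi; apply: opnorm_le => // x.
rewrite rep_algB exprS rep_algM -(aff_alg_linear_action pi m) (le_trans (FC _ _ _ Fpi _))//.
rewrite displacement_linear_action -!mulrA ler_wpM2l//.
rewrite (le_trans (displacement_rep_alg_expr n x Fpi))//.
by rewrite [2^-1 ^+ n * _]mulrC mulrA ler_wpM2r ?exprn_ge0 ?invr_ge0// FL.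
Qed.

Lemma expr_cauchy : (fun n => m ^+ n) \in cauchyp (F_seminorm Fb).
Proof.
have [C C0 mC] := F_norm_expr_step.
have dC i j : (i <= j)%N -> F_seminorm Fb (m ^+ i - m ^+ j) <= 2 * C * 2^-1 ^+ i.
  apply: (@geometric_chain _ (fun i j => F_seminorm Fb (m ^+ i - m ^+ j))) => //.
  - by move=> n; rewrite subrr sn0.
  - by move=> *; exact: sn_dist.
apply/asboolP => e e0; have [k ek] := geometric_small (2 * C) e0.
exists k => i j ki kj; have [ij|/ltnW ji] := leqP i j.
  exact: le_lt_trans (dC _ _ ij) (ek _ ki).
by rewrite snBC; exact: le_lt_trans (dC _ _ ji) (ek _ kj).
Qed.

Definition expr_cseq : cauchy_seq (F_seminorm Fb) := CauchySeq expr_cauchy.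

Lemma kazhdan_projection_expr_lim : kazhdan_projection (hcpi expr_cseq : CF Fb).
Proof.
split.
(* Idempotence says that [m^(2n) - m^n] tends to zero, which is the Cauchy property at the indices
   [n + n] and [n]. *)
- rewrite -hcpiM; apply/hcpiP/asboolP => e e0.
  have [k uk] := cseqP expr_cseq e0; exists k => n kn.
  rewrite cseqD cseqN cseqM /= -exprD; apply: uk => //.
  exact: leq_trans kn (leq_addr _ _).
- move=> B /(hcemb_cvg expr_cseq)[k _ /(_ k (leqnn k)) Bk].
  exists (CF_emb Fb (m ^+ k)); split => //.
  by exists (m ^+ k) => //=; exact: augmentation_expr.
- move=> E pi Fpi.
  have inv x : invariants pi x -> CF_rep pi (hcpi expr_cseq : CF Fb) x = x.
    move=> xi; rewrite CF_rep_lim//; apply: (cvg_lim (@norm_hausdorff _ _)).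
    under eq_fun do rewrite rep_alg_invariant// ?augmentation_expr//.
    exact: cvg_cst.
  (* The vectors [pi(m^n) x] converge to [pi(p) x] with displacement tending to zero. Together with
     [inv] this yields both idempotence and the range. *)
  have rng x : invariants pi (CF_rep pi (hcpi expr_cseq : CF Fb) x).
    move=> g; rewrite -(linear_actionE pi).
    apply: (cvg_displacement_fixed genS Fb
      (y := fun n => rep_alg pi (m ^+ n) x) (D := displacement S (fun g => pi g) x)) => //.
      exact: (CF_repE Fpi expr_cseq x).
    by move=> n; rewrite displacement_linear_action displacement_rep_alg_expr.
  split.
  + exact: CF_rep_is_linear.
  + exact: CF_rep_continuous.
  + by move=> x; exact: inv.
  + apply/seteqP; split => [_ [x _ <-]//|x xi].
    by exists x => //; exact: inv.
Qed.

End ContractionToProjection.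

(** * From a Kazhdan projection to a contracting element *)

Section ProjectionToContraction.
Variables (R : realType) (G : groupType) (S : {fset G}) (F : rep_collection R G).
Hypotheses (genS : generates S) (Fb : Defs.pointwise_bounded F).
Variables (p : CF Fb) (kp : kazhdan_projection p).

(** On the kernel of [pi(p)] the operators [pi(m)] and [pi(m - p)] agree, and density supplies [m]
    with [m - p] small in norm. *)
Lemma kazhdan_approx (e : R) : 0 < e -> exists2 m, augmentation m = 1 &
  forall (E : completeNormedModType R[i]) (pi : representation G E), F pi ->
  forall y : E, CF_rep pi p y = 0 -> rnorm (rep_alg pi m y) <= e * rnorm y.
Proof.
move=> e0; case: kp => _ cp _.
have /cp : nbhs p [set q | rnorm (p - q) < e].
  by have /cvg_rnormP := @cvg_id _ (nbhs p); exact.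
move=> [_ [[m /= m1 <-]] pm]; exists m => // E pi Fpi y py.
rewrite -(CF_rep_emb Fb Fpi).
have -> : CF_rep pi (CF_emb Fb m) y = CF_rep pi (CF_emb Fb m - p) y.
  by rewrite CF_repD// -scaleN1r CF_repZ// py scaler0 addr0.
rewrite (le_trans (CF_rep_le _ _ _))// ler_wpM2r ?rnorm_ge0//.
by rewrite rnorm_distC ltW.
Qed.

Lemma kazhdan_contraction :
  exists m, augmentation m = 1 /\ contracts_displacement S F m.
Proof.
have half0 : 0 < 2^-1 :> R by rewrite invr_gt0.
have [m0 m01 m0p] := kazhdan_approx half0.
have [C C0 FC] := alg_move_le_displacement genS Fb m01.
have [L L0 FL] := displacement_le_norm S Fb.
have CL1 : 0 < 4 * C * L + 1 by rewrite ltr_wpDl// !mulr_ge0.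
(* The final estimate is [L * e * (2 * C * d)], at most [d / 2] as soon as [4 * C * L * e <= 1]; the
   added [1] keeps the denominator positive. *)
have e0 : 0 < (4 * C * L + 1)^-1 by rewrite invr_gt0.
have [m mm1 mp] := kazhdan_approx e0.
exists m; split => // E pi Fpi x.
have [_ _ /(_ E pi Fpi)[_ _ pp rp]] := kp.
set z := CF_rep pi p x; have zi : invariants pi z by rewrite -rp; exists x.
pose y := x - z.
have py : CF_rep pi p y = 0.
  rewrite /y addrC -scaleN1r CF_rep_is_linear// scaleN1r.
  by rewrite /z pp addNr.
have dy w : displacement S (fun g => pi g) (w + z) = displacement S (fun g => pi g) w.
  by apply: eq_displacement => s; rewrite linearD zi [w + z]addrC addrKA.
have xE : x = y + z by rewrite subrK.
rewrite xE linearD/= (rep_alg_invariant mm1 zi) !dy.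
have := FC E pi (linear_action pi) Fpi y.
rewrite aff_alg_linear_action displacement_linear_action.
set d := displacement S _ y => h1.
have h2 := m0p E pi Fpi y py.
have h3 : rnorm y <= rnorm (y - rep_alg pi m0 y) + rnorm (rep_alg pi m0 y).
  by rewrite -{1}(subrK (rep_alg pi m0 y) y) rnormD.
(* The second term of [h3] is at most half of [rnorm y] and is absorbed on the left. *)
have y2C : rnorm y <= 2 * C * d by lra.
have d0 : 0 <= d by exact: displacement_ge0.
rewrite (le_trans (FL _ _ Fpi _))//.
rewrite (le_trans (ler_wpM2l L0 (mp _ _ Fpi _ py)))//.
rewrite mulrCA [leLHS]mulrC ler_pdivrMr//.
have := ler_wpM2l L0 y2C; lra.
Qed.

End ProjectionToContraction.

(** * The equivalence and the affine fixed point criterion *)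

Theorem theorem1p2 (R : realType) (G : groupType) (S : {fset G})
    (symS : symmetric_set S) (genS : generates S)
    (F : rep_collection R G)
    (bF : forall g, g \in S -> has_ubound (group_norms F g)) :
  ((exists p : CF (pointwise_bounded_gen symS genS bF), kazhdan_projection p) <->
   (exists m : group_algebra R[i] G,
      augmentation m = 1 /\ contracts_displacement S F m)) /\
  (forall m : group_algebra R[i] G,
     augmentation m = 1 -> contracts_displacement S F m ->
     forall (E : completeNormedModType R[i]) (pi : representation G E)
            (sigma : affine_action pi),
       F E pi ->
       (exists x : E, forall g, sigma g x = x) <->
       (forall x : E,
          displacement S sigma (aff_alg sigma m x)
          <= 2^-1 * displacement S sigma x)).
Proof.
have Fb := pointwise_bounded_gen symS genS bF.
split; first split.
- by move=> [p kp]; exact: (kazhdan_contraction genS kp).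
- by move=> [m [m1 mS]]; eexists; exact: (kazhdan_projection_expr_lim genS _ m1 mS).
- move=> m m1 mS E pi sigma Fpi; split; last first.
    exact: (affine_contraction_fixed_point genS Fb m1 Fpi).
  move=> [x0 fx0] x.
  (* Moving the origin to the fixed point [x0] reduces the claim to the contraction for [pi]. *)
  have dE y : displacement S sigma y = displacement S (fun g => pi g) (y - x0).
    apply: eq_displacement => s; rewrite -(aff_opB sigma) fx0 opprB addrA.
    by rewrite subrK.
  by rewrite !dE aff_alg_fixed//; exact: mS.
Qed.
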